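(* Given an instance with chores and (possibly heterogeneous) quantiles with $m=kn$, a balanced allocation minimizing egalitarian social cost among all balanced allocations can be computed in polynomial time.
   Context: There is a set $N$ of $n$ agents and a set $M$ of $m$ indivisible items (chores). Each agent $i$ has a disutility $d_i(g)\ge 0$ for each item $g$ and a quantile $\tau_i\in[0,1]$. For a nonempty bundle $S$, order its items as $g_1,\dots,g_{|S|}$ with $d_i(g_1)\ge\dots\ge d_i(g_{|S|})$; then $d_i(S)=d_i(g_{\lceil\tau_i|S|\rceil})$ if $\tau_i>0$ and $d_i(S)=d_i(g_1)$ if $\tau_i=0$ (this is $-v_i(S)$ for the quantile valuation with item values $v_i=-d_i$). An allocation is an $n$-partition $A=(A_1,\dots,A_n)$ of $M$; when $m=kn$ it is balanced if $|A_i|=k$ for all $i$. The egalitarian social cost is $\mathrm{ESC}(A)=\max_{i\in N}d_i(A_i)$. *)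

(* Defs.v *)
From mathcomp Require Import all_boot all_order all_algebra.
Set Implicit Arguments. Unset Strict Implicit. Unset Printing Implicit Defensive.
Import Order.TTheory GRing.Theory Num.Theory.
Local Open Scope ring_scope.

(* Agents are 'I_n, items are 'I_m.  An allocation (n-partition of M,  *)
(* parts possibly empty) is represented by its assignment map          *)
(* a : 'I_m -> 'I_n, bundle A_i = [set g | a g == i].                  *)

(* ceiling of t * s for 0 <= t <= 1: least c in {0..s} with t*s <= c *)
Definition qceil (R : realFieldType) (t : R) (s : nat) : nat :=
  find (fun c : nat => t * s%:R <= c%:R) (iota 0 s.+1).

(* d_i(S): sort S by decreasing disutility g_1, ..., g_|S|, and return
   d_i(g_{ceil(tau |S|)}) if tau > 0, d_i(g_1) if tau = 0.
   (Empty bundle: 0 by convention; never relevant when k >= 1.) *)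
Definition qdis (R : realFieldType) (m : nat) (di : 'I_m -> R) (ti : R)
    (S : {set 'I_m}) : R :=
  let s := map di (sort (fun g h : 'I_m => di h <= di g) (enum S)) in
  if 0 < ti then nth 0 s (qceil ti #|S|).-1 else nth 0 s 0.

Definition bundle (n m : nat) (a : 'I_m -> 'I_n) (i : 'I_n) : {set 'I_m} :=
  [set g | a g == i].

Definition balanced (n m k : nat) (a : 'I_m -> 'I_n) : Prop :=
  forall i : 'I_n, #|bundle a i| = k.

(* egalitarian social cost  max_i d_i(A_i)  (disutilities are >= 0) *)
Definition ESC (R : realFieldType) (n m : nat) (d : 'I_n -> 'I_m -> R)
    (tau : 'I_n -> R) (a : 'I_m -> 'I_n) : R :=
  \big[Num.max/0]_(i : 'I_n) qdis (d i) (tau i) (bundle a i).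

(* Computation model: unit-cost RAM with natural-number memory, only   *)
(* addition and truncated subtraction (no multiplication), indirect    *)
(* addressing, and two unit-cost oracle instructions giving access to  *)
(* the real-valued input (comparison of disutilities, and comparison   *)
(* tau_i * s <= t for natural s, t).                                   *)

Inductive instr : Type :=
| IConst of nat & nat
| IAdd of nat & nat & nat
| ISub of nat & nat & nat
| ILoad of nat & nat
| IStore of nat & nat
| IJmpLe of nat & nat & nat
| ICmpD of nat & nat & nat & nat & nat
| ICmpQ of nat & nat & nat & nat
| IHalt.

Definition program := seq instr.
Definition memory := nat -> nat.

Definition upd (M : memory) (a v : nat) : memory :=
  fun x => if x == a then v else M x.

Section Machine.
Local Open Scope nat_scope.
Variables (cmpD : nat -> nat -> nat -> nat -> bool) (cmpQ : nat -> nat -> nat -> bool).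

Definition exec (ins : instr) (pc : nat) (M : memory) : nat * memory :=
  match ins with
  | IConst r v => (pc.+1, upd M r v)
  | IAdd r a b => (pc.+1, upd M r (M a + M b))
  | ISub r a b => (pc.+1, upd M r (M a - M b))
  | ILoad r a => (pc.+1, upd M r (M (M a)))
  | IStore a r => (pc.+1, upd M (M a) (M r))
  | IJmpLe a b l => (if M a <= M b then l else pc.+1, M)
  | ICmpD r i g j h => (pc.+1, upd M r (nat_of_bool (cmpD (M i) (M g) (M j) (M h))))
  | ICmpQ r i s t => (pc.+1, upd M r (nat_of_bool (cmpQ (M i) (M s) (M t))))
  | IHalt => (pc, M)
  end.

(* run for at most [fuel] steps; Some M iff the program halts (IHalt or pc
   out of range) within [fuel] steps, with final memory M *)
Fixpoint run (P : program) (fuel pc : nat) (M : memory) : option memory :=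
  match fuel with
  | 0 => None
  | f.+1 =>
    match nth IHalt P pc with
    | IHalt => Some M
    | ins => let: (pc', M') := exec ins pc M in run P f pc' M'
    end
  end.
End Machine.

Definition dnat (R : realFieldType) (n m : nat) (d : 'I_n -> 'I_m -> R)
    (i g : nat) : R :=
  match @insub _ (fun x => x < n)%N _ i, @insub _ (fun x => x < m)%N _ g with
  | Some i', Some g' => d i' g'
  | _, _ => 0
  end.

Definition taunat (R : realFieldType) (n : nat) (tau : 'I_n -> R) (i : nat) : R :=
  match @insub _ (fun x => x < n)%N _ i with Some i' => tau i' | None => 0 end.

Definition oracleD (R : realFieldType) (n m : nat) (d : 'I_n -> 'I_m -> R) :=
  fun i g j h => dnat d i g <= dnat d j h.

Definition oracleQ (R : realFieldType) (n : nat) (tau : 'I_n -> R) :=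
  fun i s t => taunat tau i * s%:R <= t%:R.

Local Open Scope nat_scope.
Definition init_mem (n m k : nat) : memory :=
  fun x => if x == 0%N then n else if x == 1%N then m else if x == 2%N then k else 0%N.

(* Main.v *)
Require Import Defs.
From mathcomp Require Import all_boot all_order all_algebra.
From mathcomp Require Import zify.
Set Implicit Arguments. Unset Strict Implicit. Unset Printing Implicit Defensive.
Import Order.TTheory GRing.Theory Num.Theory.

(* Give agent i the slots j < k, where j is strict if tau_i k <= j + 1 and free
   otherwise.  A balanced allocation has cost at most theta iff the items can be
   assigned bijectively to the slots so that each strict slot of i receives an
   item with d_i <= theta: a bundle is acceptable to i iff at most
   ceil(tau_i k) - 1 of its items exceed theta.  The optimal theta is one of the
   d_i(g), so all of them are tried.  For a given theta the slots bid in turn: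
   the bidding slot takes an acceptable item of least height, evicting the
   previous holder, and the height of that item increases by one.  Heights stay
   at most m, which bounds the number of bids by m^2; if all items acceptable to
   the bidder have height at least m, some level l <= m is empty, and the items
   above it violate Hall's condition. *)
Local Open Scope nat_scope.

(** * Hall violators from heights *)

(** Pigeonhole: choosing a preimage of every level would inject [#|G|.+1] levels into [G]. *)
Lemma gap_level (G : finType) (h : G -> nat) :
  exists2 l, l <= #|G| & forall g, h g != l.
Proof.
case: (boolP [exists l : 'I_#|G|.+1, [forall g, h g != l]]) => [/existsP[l /forallP hl]|].
  by exists l; first by rewrite -ltnS ltn_ord.
rewrite negb_exists => /forallP full.
have hit (l : 'I_#|G|.+1) : exists g, h g == l.
  by have := full l; rewrite negb_forall => /existsP[g]; rewrite negbK; exists g.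
have inj : injective (fun l => xchoose (hit l)).
  move=> l1 l2 E; apply: val_inj.
  by rewrite /= -(eqP (xchooseP (hit l1))) E (eqP (xchooseP (hit l2))).
by have := leq_card _ inj; rewrite card_ord ltnn.
Qed.

Lemma card_fibers (G C : finType) (P : pred G) (f : G -> C) (X : {set C}) :
  \sum_(x in X) #|[pred g | P g & f g == x]| = #|[pred g | P g & f g \in X]|.
Proof.
rewrite -sum1_card (partition_big f [in X]) => [|g /andP[]//].
apply: eq_bigr => x xX; rewrite -sum1_card; apply: eq_bigl => g /=.
by rewrite !inE; case: eqP => [->|]; rewrite ?xX ?andbF ?andbT.
Qed.

(* Above an empty level l of h, the owners together with [cur] accept only the
   items above l, which the owners alone already use up. *)
Lemma stuck_infeasible (G C : finType) (acc : C -> G -> bool) (cap : C -> nat)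
    (h : G -> nat) (own : G -> C) (cur : C) (f : G -> C) :
    (forall g, 0 < h g -> forall g', acc (own g) g' -> h g <= (h g').+1) ->
    (forall g, acc cur g -> #|G| <= h g) ->
    (forall x, #|[pred g | 0 < h g & own g == x]| + (x == cur) <= cap x) ->
    (forall g, acc (f g) g) -> (forall x, #|[pred g | f g == x]| = cap x) ->
  False.
Proof.
move=> hcs hcur hcap hacc hf; have [l le_l hl] := gap_level h.
pose X := [set x | (x == cur) || [exists g, (l < h g) && (own g == x)]].
(* A held item above [l] forces every item acceptable to its owner to height at least [l], and level
   [l] is empty. For [cur] these heights are at least [#|G| >= l]. *)
have nbr x g : x \in X -> acc x g -> l < h g.
  rewrite ltn_neqAle eq_sym hl inE => /orP[/eqP->|/existsP[g' /andP[lg' /eqP<-]]] a /=.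
    exact: leq_trans le_l (hcur _ a).
  by rewrite -ltnS; apply: (leq_trans lg' (hcs g' _ g a)); apply: leq_ltn_trans lg'.
have curX : cur \in X by rewrite inE eqxx.
(* Strict because the bidding slot of [cur] holds no item. *)
have lt : #|[pred g | 0 < h g & own g \in X]| < \sum_(x in X) cap x.
  rewrite -(card_fibers (fun g => 0 < h g)) (bigD1 cur) //= [X in _ < X](bigD1 cur) //= -addSn leq_add //.
    by have := hcap cur; rewrite eqxx addn1.
  by apply: leq_sum => x _; apply: leq_trans (hcap x); apply: leq_addr.
move: lt; rewrite ltnNge => /negP; apply.
under eq_bigr => x _ do rewrite -hf.
rewrite (card_fibers xpredT); apply/subset_leq_card/subsetP => g /andP[_ fX].
have lg := nbr _ _ fX (hacc g).
by rewrite !inE (leq_ltn_trans _ lg) //=; apply/orP; right; apply/existsP; exists g; rewrite lg eqxx.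
Qed.

(** Both counts agree off [b]. The old owner of [b] loses an item only if [P b]; in the auction [P]
    says that the item is held, so the summand on the left records the eviction. *)
Lemma card_reassign (G C : finType) (P P' : pred G) (own : G -> C) (b : G) (x y : C) :
    P' b -> (forall g, g != b -> P' g = P g) ->
  #|[pred g | P' g & (if g == b then x else own g) == y]| + (P b && (y == own b)) =
  #|[pred g | P g & own g == y]| + (y == x).
Proof.
move=> Pb' eqP'; pose A := [pred g | P g & own g == y].
pose A' := [pred g | P' g & (if g == b then x else own g) == y].
have E : #|[predD1 A' & b]| = #|[predD1 A & b]|.
  by apply: eq_card => g; rewrite !inE; have [//|ne] := eqVneq g b; rewrite /= eqP'.
rewrite -/A -/A' (cardD1 b A) (cardD1 b A') E !inE eqxx Pb' /= (eq_sym y) (eq_sym y).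
by rewrite addnC addnCA addnC.
Qed.

(** * The program *)

Local Notation rOut := 0 (only parsing).
Local Notation rM := 1 (only parsing).
Local Notation rK := 2 (only parsing).
Local Notation rN := 3 (only parsing).
Local Notation rZero := 4 (only parsing).
Local Notation rOne := 5 (only parsing).
Local Notation rH := 6 (only parsing).
Local Notation rO := 7 (only parsing).
Local Notation rF := 8 (only parsing).
Local Notation rTI := 9 (only parsing).
Local Notation rTG := 10 (only parsing).
Local Notation rBI := 11 (only parsing).
Local Notation rBG := 12 (only parsing).
Local Notation rHas := 13 (only parsing).
Local Notation rI := 14 (only parsing).
Local Notation rJ := 15 (only parsing).
Local Notation rX := 16 (only parsing).
Local Notation rS := 17 (only parsing).
Local Notation rG := 18 (only parsing).
Local Notation rMin := 19 (only parsing).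
Local Notation rArg := 20 (only parsing).
Local Notation rT := 21 (only parsing).
Local Notation rV := 22 (only parsing).
Local Notation rX' := 23 (only parsing).
Local Notation rS' := 24 (only parsing).

Local Notation lTry := 4 (only parsing).
Local Notation lSlot := 13 (only parsing).
Local Notation lBid := 16 (only parsing).
Local Notation lScan := 18 (only parsing).
Local Notation lAcc := 25 (only parsing).
Local Notation lSkip := 27 (only parsing).
Local Notation lPlace := 29 (only parsing).
Local Notation lFresh := 43 (only parsing).
Local Notation lAgent := 46 (only parsing).
Local Notation lDone := 50 (only parsing).
Local Notation lNext := 54 (only parsing).
Local Notation lWrap := 58 (only parsing).
Local Notation lHalt := 61 (only parsing).

(* Cells 0-24 are registers.  [IAdd _ _ rZero] is a move and [IJmpLe rZero rZero _]
   a goto.  Every auction gets three fresh (hence zero) arrays of length m: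
   the heights at rH, and at rO and rF the agent and the strictness flag of the
   slot holding each item.  (rTI, rTG) is the threshold under trial, (rBI, rBG)
   the best feasible one so far if rHas = 1, (rX, rS) the slot that is bidding. *)
Definition prog : program := [::
  IAdd rN rOut rZero; IConst rOne 1; IConst rH 32; IJmpLe rM rZero lHalt;
  (* lTry *)
  IJmpLe rN rTI lHalt; IAdd rO rH rM; IAdd rF rO rM;
  ICmpD rT rBI rBG rTI rTG; IAdd rT rT rHas; ISub rT rT rOne; IJmpLe rOne rT lNext;
  IConst rI 0; IConst rJ 0;
  (* lSlot *)
  IAdd rT rJ rOne; ICmpQ rS rI rK rT; IAdd rX rI rZero;
  (* lBid *)
  IAdd rMin rM rZero; IConst rG 0;
  (* lScan *)
  IJmpLe rM rG lPlace; IAdd rT rH rG; ILoad rV rT; IJmpLe rMin rV lSkip;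
  IJmpLe rS rZero lAcc; ICmpD rT rX rG rTI rTG; IJmpLe rT rZero lSkip;
  (* lAcc *)
  IAdd rMin rV rZero; IAdd rArg rG rZero;
  (* lSkip *)
  IAdd rG rG rOne; IJmpLe rZero rZero lScan;
  (* lPlace *)
  IJmpLe rM rMin lNext;
  IAdd rT rH rArg; IAdd rV rMin rOne; IStore rT rV;
  IAdd rT rO rArg; ILoad rX' rT; IStore rT rX;
  IAdd rT rF rArg; ILoad rS' rT; IStore rT rS;
  IJmpLe rMin rZero lFresh; IAdd rX rX' rZero; IAdd rS rS' rZero; IJmpLe rZero rZero lBid;
  (* lFresh *)
  IAdd rJ rJ rOne; IJmpLe rK rJ lAgent; IJmpLe rZero rZero lSlot;
  (* lAgent *)
  IConst rJ 0; IAdd rI rI rOne; IJmpLe rN rI lDone; IJmpLe rZero rZero lSlot;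
  (* lDone *)
  IAdd rOut rO rZero; IAdd rBI rTI rZero; IAdd rBG rTG rZero; IConst rHas 1;
  (* lNext *)
  IAdd rH rF rM; IAdd rTG rTG rOne; IJmpLe rM rTG lWrap; IJmpLe rZero rZero lTry;
  (* lWrap *)
  IConst rTG 0; IAdd rTI rTI rOne; IJmpLe rZero rZero lTry;
  (* lHalt *)
  IHalt].

(** * Symbolic execution of the program *)

Lemma upd_eq M a v : upd M a v a = v.
Proof. by rewrite /upd eqxx. Qed.

Lemma upd_ne M a v x : x != a -> upd M a v x = M x.
Proof. by rewrite /upd => /negbTE->. Qed.

Section Machine.
Variables (cmpD : nat -> nat -> nat -> nat -> bool) (cmpQ : nat -> nat -> nat -> bool).

(** Quantifying over the remaining fuel lets segments compose with their step counts added, before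
    anything is known about halting. *)
Definition reach (t pc : nat) (M : memory) (pc' : nat) (M' : memory) : Prop :=
  forall f, run cmpD cmpQ prog (t + f) pc M = run cmpD cmpQ prog f pc' M'.

Lemma reach0 pc M : reach 0 pc M pc M.
Proof. by []. Qed.

Lemma reach_trans t1 t2 pc1 M1 pc2 M2 pc3 M3 :
  reach t1 pc1 M1 pc2 M2 -> reach t2 pc2 M2 pc3 M3 ->
  reach (t1 + t2) pc1 M1 pc3 M3.
Proof. by move=> r1 r2 f; rewrite -addnA r1 r2. Qed.

Section Steps.
Variables (t pc : nat) (M : memory) (pc' : nat) (M' : memory).

Lemma step_const r v : nth IHalt prog pc = IConst r v ->
  reach t pc.+1 (upd M r v) pc' M' -> reach t.+1 pc M pc' M'.
Proof. by move=> E h f; rewrite addSn /= E /= h. Qed.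

Lemma step_add r a b v : nth IHalt prog pc = IAdd r a b -> M a + M b = v ->
  reach t pc.+1 (upd M r v) pc' M' -> reach t.+1 pc M pc' M'.
Proof. by move=> E V h f; rewrite addSn /= E /= V h. Qed.

Lemma step_sub r a b v : nth IHalt prog pc = ISub r a b -> M a - M b = v ->
  reach t pc.+1 (upd M r v) pc' M' -> reach t.+1 pc M pc' M'.
Proof. by move=> E V h f; rewrite addSn /= E /= V h. Qed.

Lemma step_load r a A v : nth IHalt prog pc = ILoad r a -> M a = A -> M A = v ->
  reach t pc.+1 (upd M r v) pc' M' -> reach t.+1 pc M pc' M'.
Proof. by move=> E <- <- h f; rewrite addSn /= E /= h. Qed.

Lemma step_store a r A v : nth IHalt prog pc = IStore a r -> M a = A -> M r = v ->
  reach t pc.+1 (upd M A v) pc' M' -> reach t.+1 pc M pc' M'.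
Proof. by move=> E <- <- h f; rewrite addSn /= E /= h. Qed.

Lemma step_jmp a b l va vb : nth IHalt prog pc = IJmpLe a b l -> M a = va -> M b = vb ->
  reach t (if va <= vb then l else pc.+1) M pc' M' -> reach t.+1 pc M pc' M'.
Proof. by move=> E <- <- h f; rewrite addSn /= E /= h. Qed.

Lemma step_cmpD r i g j h vi vg vj vh : nth IHalt prog pc = ICmpD r i g j h ->
  M i = vi -> M g = vg -> M j = vj -> M h = vh ->
  reach t pc.+1 (upd M r (cmpD vi vg vj vh)) pc' M' -> reach t.+1 pc M pc' M'.
Proof. by move=> E <- <- <- <- hr f; rewrite addSn /= E /= hr. Qed.

Lemma step_cmpQ r i s u vi vs vu : nth IHalt prog pc = ICmpQ r i s u ->
  M i = vi -> M s = vs -> M u = vu ->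
  reach t pc.+1 (upd M r (cmpQ vi vs vu)) pc' M' -> reach t.+1 pc M pc' M'.
Proof. by move=> E <- <- <- hr f; rewrite addSn /= E /= hr. Qed.

End Steps.

Ltac ne := solve [done | lia].
Ltac look_all := repeat first [rewrite upd_eq | rewrite upd_ne; [|ne]].
Ltac look := look_all; first [eassumption | reflexivity].
Ltac lookD := look_all; repeat match goal with
  | H : ?M ?a = _ |- context [?M ?a] => rewrite H end; rewrite ?addn0; reflexivity.
Ltac step := lazymatch goal with |- reach _ ?pc _ _ _ =>
  let i := eval vm_compute in (nth IHalt prog pc) in
  lazymatch i with
  | IConst _ _ => eapply step_const; [reflexivity|]
  | IAdd _ _ _ => eapply step_add; [reflexivity|lookD|]
  | ISub _ _ _ => eapply step_sub; [reflexivity|lookD|]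
  | ILoad _ _ => eapply step_load; [reflexivity|look|look|]
  | IStore _ _ => eapply step_store; [reflexivity|look|look|]
  | IJmpLe _ _ _ => eapply step_jmp; [reflexivity|look|look|]
  | ICmpD _ _ _ _ _ => eapply step_cmpD; [reflexivity|look|look|look|look|]
  | ICmpQ _ _ _ _ => eapply step_cmpQ; [reflexivity|look|look|look|]
  end end.

(** * Selecting and placing one bid *)

Variables n m k : nat.

Lemma place_block M hp b c :
    M rM = m -> M rH = hp -> M rO = hp + m -> M rF = hp + m + m -> 32 <= hp ->
    M rArg = b -> b < m -> M rMin = c -> c < m -> M rOne = 1 ->
  exists2 M', reach 10 lPlace M 39 M' &
    [/\ M' (hp + b) = c.+1, M' (hp + m + b) = M rX, M' (hp + m + m + b) = M rS,
        M' rX' = M (hp + m + b) /\ M' rS' = M (hp + m + m + b) &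
        forall a, [&& ~~ (21 <= a <= 24), a != hp + b, a != hp + m + b & a != hp + m + m + b] ->
          M' a = M a].
Proof.
move=> E1 E6 E7 E8 hp32 E20 bm E19 cm E5.
eexists.
  step; rewrite leqNgt cm /=.
  do 9 step.
  exact: reach0.
split; [by look_all; lia|by look_all|by look_all|by split; look_all|].
by move=> a ha; look_all.
Qed.

(** A threshold is named by a pair [T], standing for the disutility of item [T.2] to agent [T.1], as
    the oracle compares only such values. A bidder [y] is an agent with a strictness flag. *)
Definition acc (T : nat * nat) (y : nat * bool) (g : nat) : bool :=
  y.2 ==> cmpD y.1 g T.1 T.2.

Definition bid_regs (M : memory) hp (T : nat * nat) (y : nat * bool) : Prop :=
  [/\ M rM = m, M rZero = 0, M rOne = 1, M rH = hp &
      [/\ M rTI = T.1, M rTG = T.2, M rX = y.1 & M rS = y.2]].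

Lemma eq_bid_regs M M' hp T y :
  (forall a, a < 18 -> M' a = M a) -> bid_regs M hp T y -> bid_regs M' hp T y.
Proof. by move=> E [? ? ? ? [? ? ? ?]]; rewrite /bid_regs !E. Qed.

Lemma scan_step M hp T (y : nat * bool) g :
    bid_regs M hp T y -> 32 <= hp ->
    M rG = g -> g < m ->
  exists t M', [/\ t <= 11, reach t lScan M lScan M', M' rG = g.+1,
    (M' rMin, M' rArg) = (if (M (hp + g) < M rMin) && acc T y g then (M (hp + g), g)
                          else (M rMin, M rArg)) &
    forall a, ~~ (18 <= a <= 22) -> M' a = M a].
Proof.
move=> [E1 E4 E5 E6 [E9 E10 E16 E17]] hp32 E18 gm.
have [le|lt] := leqP (M rMin) (M (hp + g)).
  exists 6; eexists; split; first done.
  - do 1 step; rewrite leqNgt gm /=; do 3 step; rewrite le /=.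
    do 2 step; rewrite /=; exact: reach0.
  - by look_all; rewrite addn1.
  - by look_all.
  - by move=> a ha; look_all.
rewrite /= /acc; case: y.2 E17 => /= E17; last first.
  exists 9; eexists; split; first done.
  - do 1 step; rewrite leqNgt gm /=; do 3 step; rewrite leqNgt lt /=; step; rewrite /=.
    do 4 step; rewrite /=; exact: reach0.
  - by look_all; rewrite addn1.
  - by look_all.
  - by move=> a ha; look_all.
case: (boolP (cmpD _ _ _ _)) => c.
  exists 11; eexists; split; first done.
  - do 1 step; rewrite leqNgt gm /=; do 3 step; rewrite leqNgt lt /=; step; rewrite /=.
    step; step; rewrite c /=; do 4 step; rewrite /=; exact: reach0.
  - by look_all; rewrite addn1.
  - by look_all.
  - by move=> a ha; look_all.
exists 9; eexists; split; first done.
- do 1 step; rewrite leqNgt gm /=; do 3 step; rewrite leqNgt lt /=; step; rewrite /=.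
  step; step; rewrite (negbTE c) /=; do 2 step; rewrite /=; exact: reach0.
- by look_all; rewrite addn1.
- by look_all.
- by move=> a ha; look_all.
Qed.

(** The scan starts from height [m], so [c >= m] reports that no acceptable item lies below it; [b]
    is then meaningless. *)
Definition best_bid (M : memory) hp T y b c : Prop :=
  (forall g, g < m -> acc T y g -> c <= M (hp + g)) /\
  (c < m -> [/\ b < m, acc T y b & M (hp + b) = c]).

Lemma scan_loop M hp T (y : nat * bool) g :
    bid_regs M hp T y -> 32 <= hp ->
    M rG = g -> g <= m ->
    (forall g', g' < g -> acc T y g' -> M rMin <= M (hp + g')) ->
    (M rMin < m -> [/\ M rArg < m, acc T y (M rArg) & M (hp + M rArg) = M rMin]) ->
    M rMin <= m ->
  exists t M', [/\ t <= 11 * (m - g) + 1, reach t lScan M lPlace M',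
    best_bid M hp T y (M' rArg) (M' rMin) & forall a, ~~ (18 <= a <= 22) -> M' a = M a].
Proof.
move=> R hp32.
have [r] := ubnP (m - g); elim: r => // r IH in M g R * => lt_r.
move=> E18 le_gm hmin harg le_min.
have [gm|mg] := ltnP g m; last first.
  have -> : g = m by apply/eqP; rewrite eqn_leq le_gm.
  exists 1, M; split; [by rewrite subnn| |split=> // g' g'm|by []].
    by case: R => E1 _ _ _ _; step; rewrite mg; apply: reach0.
  by apply: hmin; apply: leq_trans mg.
have [t1 [M1 [ht1 r1 G1 N1 F1]]] :=
  scan_step R hp32 E18 gm.
have Fh g' : M1 (hp + g') = M (hp + g') by apply: F1; lia.
have pM p q : (M1 rMin, M1 rArg) = (p, q) -> M1 rMin = p /\ M1 rArg = q by case.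
have R1 : bid_regs M1 hp T y by apply: eq_bid_regs R => a lt_a; apply: F1; lia.
case: (IH M1 g.+1 R1); rewrite ?G1 //; first by lia.
- move=> g'; rewrite ltnS leq_eqVlt Fh => /orP[/eqP->|lt_g'] a.
    by move: N1; rewrite a andbT; case: ltnP => ? /pM[-> _].
  have := hmin _ lt_g' a => hm.
  by move: N1; case: ifP => [/andP[lt _]|_] /pM[-> _] //; apply: leq_trans hm; apply: ltnW.
- by move: N1; rewrite Fh; case: ifP => [/andP[lt a]|_] /pM[-> ->].
- by move: N1; case: ifP => [/andP[lt a]|_] /pM[-> _] //; lia.
move=> t2 [M2 [ht2 r2 [B2 A2] F2]].
exists (t1 + t2), M2; split; first by lia.
- exact: reach_trans r1 r2.
- split=> [g' g'm a|lt2]; first by rewrite -Fh; apply: B2.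
  by rewrite -Fh; apply: A2.
- by move=> a ha; rewrite F2 // F1.
Qed.

Lemma bid_block M hp T (y : nat * bool) :
    bid_regs M hp T y -> 32 <= hp ->
  exists t M', [/\ t <= 11 * m + 3, reach t lBid M lPlace M',
    best_bid M hp T y (M' rArg) (M' rMin) & forall a, ~~ (18 <= a <= 22) -> M' a = M a].
Proof.
move=> R hp32.
pose M1 := upd (upd M rMin m) rG 0.
have F1 a : a != 18 -> a != 19 -> M1 a = M a by move=> ??; rewrite /M1; look_all.
have R1 : bid_regs M1 hp T y by apply: eq_bid_regs R => a lt_a; apply: F1; lia.
have r1 : reach 2 lBid M lScan M1.
  by case: R => E1 E4 _ _ _; do 2 step; exact: reach0.
have M1m : M1 rMin = m by rewrite /M1; look_all.
case: (@scan_loop M1 hp T y 0 R1); rewrite ?M1m ?ltnn // => t [M2 [ht r2 [B2 A2] F2]].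
have Fh g : M1 (hp + g) = M (hp + g) by apply: F1; lia.
exists (2 + t), M2; split; [lia|exact: reach_trans r1 r2| |].
- split=> [g' g'm a|lt2]; first by rewrite -Fh; apply: B2.
  by rewrite -Fh; apply: A2.
- by move=> a ha; rewrite F2 // F1; lia.
Qed.

(** * Slots and the auction for one threshold *)

Hypothesis m_kn : m = k * n.

(** Slots of one agent with the same strictness are interchangeable, so a slot is recorded only as
    agent and flag; capacities keep the multiplicities. *)
Definition code : finType := ('I_n * bool)%type.

Definition natcode (y : code) : nat * bool := (val y.1, y.2).

Definition cap_upto (l : nat) (y : code) : nat :=
  count (fun j => cmpQ y.1 k j.+1 == y.2) (iota 0 l).

(** The slots that have entered the auction, in lexicographic order, up to and including slot [j] of
    agent [i]. *)
Definition slots_upto i j (y : code) : nat :=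
  cap_upto (if y.1 < i then k else if y.1 == i :> nat then j.+1 else 0) y.

(** An acceptable bijection from items to slots, up to permuting slots with the same code. *)
Definition feasible T (f : 'I_m -> code) : Prop :=
  (forall y, #|[pred g | f g == y]| = cap_upto k y) /\
  forall g : 'I_m, acc T (natcode (f g)) g.

Lemma cap_uptoS l y : cap_upto l.+1 y = cap_upto l y + (cmpQ y.1 k l.+1 == y.2).
Proof. by rewrite /cap_upto -[in iota _ _]addn1 iotaD count_cat /= add0n addn0. Qed.

Lemma cap_upto_le l y : l <= k -> cap_upto l y <= cap_upto k y.
Proof.
by move=> lk; rewrite /cap_upto -(subnKC lk) iotaD count_cat leq_addr.
Qed.

Lemma sum_cap : \sum_y cap_upto k y = m.
Proof.
rewrite -(pair_bigA _ (fun i b => cap_upto k (i, b))) /= m_kn.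
rewrite (eq_bigr (fun=> k)) => [|i _]; first by rewrite sum_nat_const card_ord mulnC.
rewrite big_bool /= /cap_upto -[RHS](size_iota 0 k).
rewrite -(count_predC (fun j => cmpQ i k j.+1)); congr (_ + _); apply: eq_count => j /=.
  by rewrite eqb_id.
by rewrite eqbF_neg.
Qed.

Lemma slots_upto_le i j y : j < k -> slots_upto i j y <= cap_upto k y.
Proof. by move=> jk; apply: cap_upto_le; case: ifP => // _; case: ifP. Qed.

Lemma slots_upto_next (i : 'I_n) j y (x : code) : x = (i, cmpQ i k j.+2) ->
  slots_upto i j.+1 y = slots_upto i j y + (y == x).
Proof.
move=> ->; rewrite /slots_upto; case: y => i' b /=; rewrite xpair_eqE /=.
have [<-|ne] := eqVneq i' i; first by rewrite ltnn eqxx cap_uptoS /= [b == _]eq_sym.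
by rewrite addn0 val_eqE (negbTE ne).
Qed.

Lemma slots_upto_agent (i i' : 'I_n) j y (x : code) :
    j.+1 = k -> i' = i.+1 :> nat -> x = (i', cmpQ i' k 1) ->
  slots_upto i' 0 y = slots_upto i j y + (y == x).
Proof.
move=> jk ii' ->; rewrite /slots_upto jk; case: y => a b /=; rewrite xpair_eqE /=.
have [E|ne] := eqVneq a i'.
  rewrite E; have ai: (i' < i) = false by lia.
  by rewrite ltnn eqxx cap_uptoS /= [b == _]eq_sym ai; have -> : (i' == i :> nat) = false by lia.
rewrite val_eqE (negbTE ne) addn0 ii' ltnS leq_eqVlt.
by case: (ltngtP (val a) i).
Qed.

Lemma slots_upto_last (i : nat) j (y : code) :
  i.+1 = n -> j.+1 = k -> slots_upto i j y = cap_upto k y.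
Proof.
move=> i_n jk; rewrite /slots_upto jk.
have : y.1 <= i by rewrite -ltnS i_n ltn_ord.
by case: ltngtP.
Qed.

(** Height 0 marks an item never taken, whose [own] value is arbitrary. The last clause is preserved
    because the owner took an item of least height, the bid added one, and heights never
    decrease. *)
Definition heap_ok (M : memory) hp T (own : 'I_m -> code) : Prop :=
  forall g : 'I_m, 0 < M (hp + g) ->
  [/\ M (hp + m + g) = (own g).1, M (hp + m + m + g) = (own g).2,
      acc T (natcode (own g)) g &
      forall g' : 'I_m, acc T (natcode (own g)) g' -> M (hp + g) <= (M (hp + g')).+1].

Definition owned (M : memory) hp (own : 'I_m -> code) (y : code) : nat :=
  #|[pred g : 'I_m | 0 < M (hp + g) & own g == y]|.

Definition slot_regs (M : memory) hp i j : Prop :=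
  [/\ M rK = k, M rN = n, M rO = hp + m, M rF = hp + m + m & M rI = i /\ M rJ = j].

(** Slot [j] of agent [i] is the latest to enter, while the bidder [x] may be an earlier one that
    was evicted. By [au_count] the bidder is the only entered slot without an item. *)
Record auction (M : memory) hp T (i : 'I_n) j (x : code) own : Prop := Auction {
  au_bid : bid_regs M hp T (natcode x);
  au_slot : slot_regs M hp i j;
  au_j : j < k;
  au_heap : heap_ok M hp T own;
  au_count : forall y, owned M hp own y + (y == x) = slots_upto i j y }.

Lemma eq_heap M M' hp T own : 32 <= hp -> (forall a, 32 <= a -> M' a = M a) ->
  heap_ok M hp T own -> heap_ok M' hp T own.
Proof.
move=> hp32 E H g; rewrite !E; try lia.
by move=> /H[? ? ? cs]; split=> // g' /cs; rewrite E //; lia.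
Qed.

Lemma eq_owned M M' hp own y : (forall g : 'I_m, M' (hp + g) = M (hp + g)) ->
  owned M' hp own y = owned M hp own y.
Proof. by move=> E; apply: eq_card => g; rewrite !inE E. Qed.

Definition frame hp (M M' : memory) : Prop :=
  forall a, ~~ (14 <= a <= 24) -> ~~ (hp <= a < hp + m + m + m) -> M' a = M a.

(** Potential bounding the number of bids: each bid raises one height that is below [m]. *)
Definition slack (M : memory) hp : nat := \sum_(g < m) (m - M (hp + g)).

Lemma auction_stuck M hp T i j x own b c :
    auction M hp T i j x own -> best_bid M hp T (natcode x) b c -> m <= c ->
  forall f, ~ feasible T f.
Proof.
move=> [_ _ jk hok cnt] [cmin _] mc f [hf hacc].
apply: (@stuck_infeasible 'I_m code (fun y g => acc T (natcode y) g) (cap_upto k)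
  (fun g => M (hp + g)) own x f _ _ _ hacc hf).
- by move=> g /hok[].
- by move=> g a; rewrite card_ord; apply: leq_trans mc (cmin _ _ a).
- by move=> y; rewrite -/(owned M hp own y) cnt slots_upto_le.
Qed.

(** The new holder satisfies the height inequality because [c] was least; for the other holders it
    survives since heights only increase. An item of height 0 evicts nobody, hence the condition
    [0 < c]. *)
Lemma heap_place M M' hp T own x (b : 'I_m) c :
    heap_ok M hp T own -> best_bid M hp T (natcode x) b c -> c < m ->
    M' (hp + b) = c.+1 -> M' (hp + m + b) = x.1 -> M' (hp + m + m + b) = x.2 ->
    (forall g : 'I_m, g != b -> [/\ M' (hp + g) = M (hp + g),
        M' (hp + m + g) = M (hp + m + g) & M' (hp + m + m + g) = M (hp + m + m + g)]) ->
  [/\ heap_ok M' hp T (fun g => if g == b then x else own g), slack M' hp < slack M hp &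
      forall y, owned M' hp (fun g => if g == b then x else own g) y
        + ((0 < c) && (y == own b)) = owned M hp own y + (y == x)].
Proof.
move=> hok [cmin cbest] cm hb ob sb E; have [_ ab cb] := cbest cm.
have le_h (g : 'I_m) : M (hp + g) <= M' (hp + g).
  by have [->|ne] := eqVneq g b; [rewrite hb cb | have [->] := E _ ne].
split.
- move=> g; have [->|ne] := eqVneq g b => [_|].
    split=> // g' a; rewrite hb ltnS; apply: leq_trans (le_h g').
    exact: cmin.
  have [-> -> ->] := E _ ne => /hok[-> -> ag cs]; split=> // g' /cs le.
  by apply: leq_trans le _; rewrite ltnS.
- rewrite /slack (bigD1 b) //= [X in _ < X](bigD1 b) //= hb cb -addSn leq_add //.
    by lia.
  by apply: leq_sum => g _; apply: leq_sub2l.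
- move=> y; rewrite -cb.
  apply: (@card_reassign _ _ (fun g : 'I_m => 0 < M (hp + g))
    (fun g : 'I_m => 0 < M' (hp + g))) => [|g ne]; first by rewrite hb.
  by have [->] := E _ ne.
Qed.

Lemma eq_slack M M' hp : (forall g : 'I_m, M' (hp + g) = M (hp + g)) ->
  slack M' hp = slack M hp.
Proof. by move=> E; apply: eq_bigr => g _; rewrite E. Qed.

Lemma slot_block M hp T (i : 'I_n) j :
    M rM = m -> M rZero = 0 -> M rOne = 1 -> M rH = hp -> M rTI = T.1 -> M rTG = T.2 ->
    slot_regs M hp i j ->
  exists M', [/\ reach 3 lSlot M lBid M',
    bid_regs M' hp T (natcode (i, cmpQ i k j.+1)), slot_regs M' hp i j &
    forall a, ~~ (14 <= a <= 24) -> M' a = M a].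
Proof.
move=> E1 E4 E5 E6 E9 E10 [EK EN EO EF [EI EJ]].
eexists; split.
- do 3 step; exact: reach0.
- by split; [..|split]; look_all => //; rewrite addn1.
- by split; [..|split]; look_all.
- by move=> a ha; look_all.
Qed.

(** The outcomes of one bid are a Hall violation, a further bid, or the placement of the last
    slot. *)
Lemma auction_step M hp T i j x own : 32 <= hp -> auction M hp T i j x own ->
  exists t M', [/\ t <= 11 * m + 25, frame hp M M' &
    [\/ reach t lBid M lNext M' /\ (forall f, ~ feasible T f),
        exists i' j' x' own', [/\ reach t lBid M lBid M',
          auction M' hp T i' j' x' own' & slack M' hp < slack M hp] |
        reach t lBid M lDone M' /\
        exists2 f, feasible T f & forall g : 'I_m, M' (hp + m + g) = (f g).1]].
Proof.
move=> hp32 A; case: (A) => R S jk hok cnt; case: (S) => EK EN EO EF [EI EJ].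
have [t1 [M1 [ht1 r1 best F1]]] := bid_block R hp32.
have R1 : bid_regs M1 hp T (natcode x) by apply: eq_bid_regs R => a lt_a; apply: F1; lia.
case: (R1) => E1 E4 E5 E6 [E9 E10 E16 E17].
move Eb : (M1 rArg) best => b best; move Ec : (M1 rMin) best => c best.
have [mc|cm] := leqP m c.
  exists (t1 + 1), M1; split; first by lia.
    by move=> a ha _; apply: F1; lia.
  apply: Or31; split; last exact: auction_stuck A best mc.
  by apply: reach_trans r1 _; step; rewrite mc; apply: reach0.
have [bm ab hb] := best.2 cm.
have FO : M1 rO = hp + m by rewrite F1.
have FF : M1 rF = hp + m + m by rewrite F1.
have [M2 r2 [hB oB sB [oX oS] F2]] := place_block E1 E6 FO FF hp32 Eb bm Ec cm E5.
pose b' : 'I_m := Ordinal bm.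
have ob : M2 (hp + m + b') = x.1 by rewrite oB E16.
have sb : M2 (hp + m + m + b') = x.2 by rewrite sB E17.
have F12 a : ~~ (18 <= a <= 24) ->
    [&& a != hp + b, a != hp + m + b & a != hp + m + m + b] -> M2 a = M a.
  by move=> ha hb'; rewrite F2 ?F1 //; lia.
have ne_b (g : 'I_m) : g != b' -> [/\ M2 (hp + g) = M (hp + g),
    M2 (hp + m + g) = M (hp + m + g) & M2 (hp + m + m + g) = M (hp + m + m + g)].
  by rewrite -val_eqE /= => ne; have := ltn_ord g; split; apply: F12; lia.
have [hok2 lt_slack cnt2] := @heap_place M M2 hp T own x b' c hok best cm hB ob sb ne_b.
set own' := fun g => _ in hok2 cnt2.
have lo a : a < 18 -> M2 a = M a by move=> lt_a; apply: F12; lia.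
have fr2 : frame hp M M2 by move=> a ha ha'; apply: F12; lia.
case: R => D1 D4 D5 D6 [D9 D10 D16 D17].
have [L1 L4 L5 L6] : [/\ M2 rM = m, M2 rZero = 0, M2 rOne = 1 & M2 rH = hp].
  by rewrite !lo.
have [L9 L10 LI LJ] : [/\ M2 rTI = T.1, M2 rTG = T.2, M2 rI = i & M2 rJ = j].
  by rewrite !lo.
have [LK LN LO LF] : [/\ M2 rK = k, M2 rN = n, M2 rO = hp + m & M2 rF = hp + m + m].
  by rewrite !lo.
have LMin : M2 rMin = c by rewrite F2 ?Ec //; lia.
have r12 := reach_trans r1 r2.
(* A free item ends the chain of evictions, so the next slot in order enters. *)
case: (posnP c) => [c0|c_gt0].
  have {}cnt2 y : owned M2 hp own' y = slots_upto i j y by rewrite -cnt -cnt2 c0 addn0.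
  pose M3 := upd M2 rJ j.+1.
  have r3 : reach 2 39 M2 44 M3.
    by step; rewrite c0 /=; step; rewrite addn1; apply: reach0.
  have [jk1|kj1] := ltnP j.+1 k.
    have S3 : slot_regs M3 hp i j.+1 by rewrite /M3; split; [..|split]; look_all.
    case: (@slot_block M3 hp T i j.+1 _ _ _ _ _ _ S3); try by rewrite /M3; look_all.
    move=> M4 [r4 R4 S4 F4].
    exists (t1 + 10 + 2 + 2 + 3), M4; split; first by lia.
      by move=> a ha ha'; rewrite F4 // /M3; look_all; apply: fr2.
    apply: Or32; exists i, j.+1, (i, cmpQ i k j.+2), own'; split.
    - apply: reach_trans r4; apply: reach_trans (reach_trans r12 r3) _.
      by rewrite /M3; step; rewrite leqNgt jk1 /=; step; apply: reach0.
    - split=> // [|y]; first by apply: (eq_heap hp32 _ hok2) => a ha; rewrite F4 /M3; look_all; lia.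
      rewrite (@slots_upto_next i j y _ (erefl _)) -cnt2; congr (_ + _).
      by apply: eq_owned => g; rewrite F4 /M3; look_all; lia.
    - by rewrite (@eq_slack M2) // => g; rewrite F4 /M3; look_all; lia.
  have jk_eq : k = j.+1 by apply/eqP; rewrite eqn_leq kj1.
  pose M4 := upd (upd M3 rJ 0) rI i.+1.
  have r4 : reach 3 44 M3 48 M4.
    by rewrite /M4 /M3; step; rewrite kj1; do 2 step; rewrite addn1; apply: reach0.
  have F4 a : ~~ (14 <= a <= 24) -> M4 a = M2 a by move=> ha; rewrite /M4 /M3; look_all.
  have [i1n|ni1] := ltnP i.+1 n.
    have S4 : slot_regs M4 hp (Ordinal i1n) 0.
      by rewrite /M4 /M3; split; [..|split]; look_all.
    case: (@slot_block M4 hp T (Ordinal i1n) 0 _ _ _ _ _ _ S4); try by rewrite F4.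
    move=> M5 [r5 R5 S5 F5].
    exists (t1 + 10 + 2 + 3 + 2 + 3), M5; split; first by lia.
      by move=> a ha ha'; rewrite F5 // F4 // fr2.
    apply: Or32; exists (Ordinal i1n), 0, (Ordinal i1n, cmpQ i.+1 k 1), own'; split.
    - apply: reach_trans r5; apply: reach_trans (reach_trans (reach_trans r12 r3) r4) _.
      by rewrite /M4 /M3; step; rewrite leqNgt i1n /=; step; apply: reach0.
    - split=> // [||y]; first by lia.
        by apply: (eq_heap hp32 _ hok2) => a ha; rewrite F5 ?F4 //; lia.
      rewrite (@slots_upto_agent i (Ordinal i1n) j y _ (esym jk_eq) (erefl _) (erefl _)) -cnt2; congr (_ + _).
      by apply: eq_owned => g; rewrite F5 ?F4 //; lia.
    - by rewrite (@eq_slack M2) // => g; rewrite F5 ?F4 //; lia.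
  have i_n : n = i.+1 by apply/eqP; rewrite eqn_leq ni1 ltn_ord.
  exists (t1 + 10 + 2 + 3 + 1), M4; split; first by lia.
    by move=> a ha ha'; rewrite F4 // fr2.
  apply: Or33; split.
    apply: reach_trans (reach_trans (reach_trans r12 r3) r4) _.
    by rewrite /M4 /M3; step; rewrite ni1; apply: reach0.
  have {}cnt2 y : owned M2 hp own' y = cap_upto k y.
    by rewrite cnt2 slots_upto_last.
  (* The held items are counted by the capacities, which sum to [m], so every item is held. *)
  have full (g : 'I_m) : 0 < M2 (hp + g).
    have : #|[pred g : 'I_m | 0 < M2 (hp + g)]| = #|'I_m|.
      rewrite card_ord -[RHS]sum_cap -(eq_bigr _ (fun y _ => cnt2 y)).
      rewrite (eq_bigl [in [set: code]]) => [|y]; last by rewrite inE.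
      rewrite (card_fibers (fun g : 'I_m => 0 < M2 (hp + g))).
      by apply: eq_card => h; rewrite !inE andbT.
    by move/subset_cardP => /(_ (subset_predT _) g); rewrite !inE.
  exists own'; last by move=> g; rewrite F4; [case: (hok2 _ (full g))|lia].
  split=> [y|g]; last by case: (hok2 _ (full g)).
  by rewrite -cnt2; apply: eq_card => g; rewrite !inE full.
(* The evicted slot is read back from the arrays and becomes the bidder; no new slot enters. *)
have [oX' oS'] : M (hp + m + b) = (own b').1 /\ M (hp + m + m + b) = (own b').2.
  by have := hok b'; rewrite /= hb => /(_ c_gt0)[-> ->].
pose M3 := upd (upd M2 rX (own b').1) rS (own b').2.
have F3 a : ~~ (14 <= a <= 24) -> M3 a = M2 a by move=> ha; rewrite /M3; look_all.
exists (t1 + 10 + 4), M3; split; first by lia.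
  by move=> a ha ha'; rewrite F3 // fr2.
apply: Or32; exists i, j, (own b'), own'; split.
- apply: reach_trans r12 _.
  have E23 : M2 rX' = (own b').1 by rewrite oX F1 //; lia.
  have E24 : M2 rS' = (own b').2 by rewrite oS F1 //; lia.
  by step; rewrite leqNgt c_gt0 /=; do 3 step; apply: reach0.
- split=> // [|y].
  + by apply: (eq_heap hp32 _ hok2) => a ha; rewrite F3 //; lia.
  + rewrite -cnt -cnt2 c_gt0; congr (_ + _).
    by apply: eq_owned => g; rewrite F3 //; lia.
- by rewrite (@eq_slack M2) // => g; rewrite F3 //; lia.
Qed.

Definition improved hp (T : nat * nat) (M' : memory) : Prop :=
  [/\ M' rOut = hp + m, M' rBI = T.1, M' rBG = T.2, M' rHas = 1 &
      exists2 f, feasible T f & forall g : 'I_m, M' (hp + m + g) = (f g).1].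

Definition kept (M M' : memory) : Prop :=
  [/\ M' rOut = M rOut, M' rBI = M rBI, M' rBG = M rBG & M' rHas = M rHas].

Definition frame_try hp (M M' : memory) : Prop :=
  (forall a, 1 <= a <= 10 -> M' a = M a) /\
  forall a, 25 <= a -> ~~ (hp <= a < hp + m + m + m) -> M' a = M a.

(** Induction on the potential: a bid takes at most [11 * m + 25] steps, and 4 more record a
    success. The [.+1] pays for the last bid. *)
Lemma auction_loop M hp T i j x own : 32 <= hp -> auction M hp T i j x own ->
  exists t M', [/\ t <= (slack M hp).+1 * (11 * m + 29), reach t lBid M lNext M',
    frame_try hp M M' & kept M M' /\ (forall f, ~ feasible T f) \/ improved hp T M'].
Proof.
move=> hp32; have [r] := ubnP (slack M hp).
elim: r => // r IH in M i j x own * => lt_r A.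
have [t1 [M1 [ht1 F1]]] := auction_step hp32 A.
have F1' : frame_try hp M M1 by split=> a *; apply: F1; lia.
case=> [[r1 infeas]|[i' [j' [x' [own' [r1 A1 lt_s]]]]]|[r1 [f ff hf]]].
- exists t1, M1; split=> //; first by rewrite mulSn; lia.
  by left; split=> //; split; apply: F1; lia.
- have lt1 : slack M1 hp < r by lia.
  have [t2 [M2 [ht2 r2 [F2l F2h] out]]] := IH _ _ _ _ _ lt1 A1.
  exists (t1 + t2), M2; split.
  + rewrite mulSn leq_add //; first by lia.
    by apply: leq_trans ht2 _; rewrite leq_mul2r lt_s orbT.
  + exact: reach_trans r1 r2.
  + by case: F1' => F1l F1h; split=> a *; [rewrite F2l ?F1l|rewrite F2h ?F1h].
  + case: out => [[[K0 K1 K2 K3] infeas]|]; [left|by right].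
    by split=> //; rewrite /kept K0 K1 K2 K3; split; apply: F1; lia.
- case: A => -[_ E4 _ E6 [E9 E10 _ _]] [_ _ EO _ _] _ _ _.
  have [G4 G7] : M1 rZero = 0 /\ M1 rO = hp + m by rewrite !F1 //; lia.
  have [G9 G10] : M1 rTI = T.1 /\ M1 rTG = T.2 by rewrite !F1 //; lia.
  pose M2 := upd (upd (upd (upd M1 rOut (hp + m)) rBI T.1) rBG T.2) rHas 1.
  exists (t1 + 4), M2; split.
  + by rewrite mulSn; lia.
  + by apply: reach_trans r1 _; do 4 step; apply: reach0.
  + by case: F1' => F1l F1h; split=> a *; rewrite /M2; look_all; [apply: F1l|apply: F1h].
  + by right; split; rewrite /M2; look_all => //; exists f => // g; look_all.
Qed.

(** * The search over all thresholds *)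

Hypothesis n_gt0 : 0 < n.
Hypothesis m_gt0 : 0 < m.

Definition try_regs (M : memory) hp (T : nat * nat) : Prop :=
  [/\ M rM = m, M rZero = 0, M rOne = 1, M rH = hp &
      [/\ M rTI = T.1, M rTG = T.2, M rK = k & M rN = n]].

(** The auction is skipped when the best threshold so far is already at most [T], since success
    could not improve it. Zero memory from [hp] on means that the auction starts with no item
    held. *)
Lemma try_block M hp T (has : bool) :
    32 <= hp -> try_regs M hp T -> T.1 < n -> M rHas = has ->
    (forall a, hp <= a -> M a = 0) ->
  exists t M', [/\ t <= (m * m).+1 * (11 * m + 29) + 12, reach t lTry M lNext M',
    (forall a, 1 <= a <= 6 \/ 9 <= a <= 10 -> M' a = M a) /\ M' rF = hp + m + m,
    forall a, 25 <= a -> ~~ (hp <= a < hp + m + m + m) -> M' a = M a &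
    let skip := has && cmpD (M rBI) (M rBG) T.1 T.2 in
    kept M M' /\ (skip \/ forall f, ~ feasible T f) \/ ~~ skip /\ improved hp T M'].
Proof.
move=> hp32 [E1 E4 E5 E6 [E9 E10 EK EN]] ltT Ehas z.
set skip := has && _.
have [M1 [r1 O1 Fl1 F1]] : exists M1, [/\ reach 7 lTry M (if skip then lNext else 11) M1,
    M1 rO = hp + m, M1 rF = hp + m + m &
    forall a, ~~ (7 <= a <= 8) -> a != rT -> M1 a = M a].
  eexists; split.
  - step; rewrite leqNgt ltT /=; do 6 step.
    (* Truncated subtraction turns the sum of two bits into their conjunction. *)
    have -> : (1 <= (cmpD (M 11) (M 12) T.1 T.2 + has - 1)) = skip.
      by rewrite /skip; case: (cmpD _ _ _ _) (has) => [] [].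
    exact: reach0.
  - by look_all.
  - by look_all.
  - by move=> a ??; look_all.
have kept1 : kept M M1 by split; apply: F1.
case: (boolP skip) r1 => [sk|nsk] r1.
  exists 7, M1; split=> //; first by lia.
  - by split=> // a ha; apply: F1; lia.
  - by move=> a ha _; apply: F1; lia.
  - by left; split=> //; left.
pose i0 : 'I_n := Ordinal n_gt0.
have k_gt0 : 0 < k by move: m_gt0; rewrite m_kn muln_gt0 => /andP[].
pose M2 := upd (upd M1 rI 0) rJ 0.
have r2 : reach 2 11 M1 lSlot M2 by do 2 step; apply: reach0.
have F2 a : ~~ (14 <= a <= 15) -> M2 a = M1 a by move=> ha; rewrite /M2; look_all.
have S2 : slot_regs M2 hp i0 0.
  by split; [rewrite F2 ?F1|rewrite F2 ?F1|rewrite F2|rewrite F2|split; rewrite /M2; look_all].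
case: (@slot_block M2 hp T i0 0 _ _ _ _ _ _ S2); try by rewrite F2 // F1.
move=> M3 [r3 R3 S3 F3].
have Fz a : ~~ (7 <= a <= 8) -> ~~ (14 <= a <= 24) -> M3 a = M a.
  by move=> *; rewrite F3 // F2 ?F1 //; lia.
have z3 a : hp <= a -> M3 a = 0 by move=> ha; rewrite Fz ?z //; lia.
set x := (i0, _) in R3.
(* No item is held yet, so any owner map will do. *)
have A3 : auction M3 hp T i0 0 x (fun=> x).
  split=> // [g|y]; first by rewrite z3 ?leq_addr.
  rewrite /owned eq_card0 => [|g]; last by rewrite !inE z3 ?leq_addr.
  rewrite /slots_upto ltn0; case: (y) => a b /=; rewrite xpair_eqE.
  have [->|ne] := eqVneq a i0; first by rewrite eqxx cap_uptoS /= [b == _]eq_sym.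
  by rewrite -[0]/(val i0) val_eqE (negbTE ne).
have [t4 [M4 [ht4 r4 [F4l F4h] out]]] := auction_loop hp32 A3.
have le_slack : slack M3 hp <= m * m.
  rewrite -[X in _ <= X * _]card_ord -sum_nat_const.
  by apply: leq_sum => g _; apply: leq_subr.
exists (7 + 2 + 3 + t4), M4; split.
- rewrite addnC leq_add2r; apply: leq_trans ht4 _.
  by rewrite leq_mul2r ltnS le_slack orbT.
- exact: reach_trans (reach_trans (reach_trans r1 r2) r3) r4.
- split=> [a ha|]; first by rewrite F4l ?Fz //; lia.
  by rewrite F4l // F3 // F2.
- by move=> a ha ha'; rewrite F4h // Fz //; lia.
- case: out => [[[K0 K1 K2 K3] infeas]|]; last by right.
  by left; split; [rewrite /kept K0 K1 K2 K3 !Fz|right].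
Qed.

(** Here [hp] is the start of the third array, so [hp + m] is the first fresh cell. *)
Lemma next_block M hp T :
    M rM = m -> M rZero = 0 -> M rOne = 1 -> M rF = hp -> M rTI = T.1 -> M rTG = T.2 ->
  exists t M', [/\ t <= 6, reach t lNext M lTry M', M' rH = hp + m,
    (M' rTI, M' rTG) = (if T.2.+1 < m then (T.1, T.2.+1) else (T.1.+1, 0)) &
    forall a, a != rH -> a != rTI -> a != rTG -> M' a = M a].
Proof.
move=> E1 E4 E5 E8 E9 E10; have [lt|le] := ltnP.
  exists 4; eexists; split; first done.
  - do 3 step; rewrite addn1 leqNgt lt /=; step; exact: reach0.
  - by look_all.
  - by look_all; rewrite E9.
  - by move=> a ???; look_all.
exists 6; eexists; split; first done.
- do 3 step; rewrite addn1 le /=; do 3 step; exact: reach0.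
- by look_all.
- by look_all; rewrite addn1.
- by move=> a ???; look_all.
Qed.

Hypothesis cmpD_total : forall i g j h, cmpD i g j h || cmpD j h i g.
Hypothesis cmpD_trans : forall i g j h i' g',
  cmpD i g j h -> cmpD j h i' g' -> cmpD i g i' g'.

Definition tried_before (T : nat * nat) (i g : nat) : bool :=
  (i < T.1) || (i == T.1) && (g < T.2).

Definition next_pair (T : nat * nat) : nat * nat :=
  if T.2.+1 < m then (T.1, T.2.+1) else (T.1.+1, 0).

(** The array of the best assignment lies between the registers and [hp], where later auctions do
    not write. The last clause also says that a feasible threshold tried earlier forces some
    assignment to have been recorded. *)
Definition optimal_upto (M : memory) hp T : Prop :=
  exists has : bool, [/\ M rHas = has,
    has -> [/\ 32 <= M rOut, M rOut + m <= hp & exists2 f, feasible (M rBI, M rBG) f &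
      forall g : 'I_m, M (M rOut + g) = (f g).1] &
    forall i g f, g < m -> tried_before T i g -> feasible (i, g) f ->
      has && cmpD (M rBI) (M rBG) i g].

Record search M hp T : Prop := Search {
  se_regs : try_regs M hp T;
  se_hp : 32 <= hp;
  se_zero : forall a, hp <= a -> M a = 0;
  se_T : T.2 < m;
  se_opt : optimal_upto M hp T }.

Lemma tried_before_next T i g : g < m -> T.2 < m ->
  tried_before (next_pair T) i g = tried_before T i g || (i == T.1) && (g == T.2).
Proof.
move=> gm Tm; rewrite /tried_before /next_pair; case: (ltnP T.2.+1 m) => /= [_|mT].
  rewrite ltnS (leq_eqVlt g).
  by case: (i < T.1) (i == T.1) (g < T.2) (g == T.2) => [] [] [] [].
rewrite ltn0 andbF orbF ltnS (leq_eqVlt i).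
have -> : (g == T.2) = ~~ (g < T.2) by lia.
by case: (i < T.1) (i == T.1) (g < T.2) => [] [] [].
Qed.

(** An improvement was not skipped, so by totality it is at most the previous best, and transitivity
    carries the earlier comparisons over. If the best is kept, [T] was either no better or
    infeasible. *)
Lemma optimal_next M M' hp T :
    optimal_upto M hp T -> 32 <= hp -> T.2 < m ->
    (forall a, 25 <= a -> ~~ (hp <= a < hp + m + m + m) -> M' a = M a) ->
    (forall has : bool, M rHas = has ->
      let skip := has && cmpD (M rBI) (M rBG) T.1 T.2 in
      kept M M' /\ (skip \/ forall f, ~ feasible T f) \/ ~~ skip /\ improved hp T M') ->
  optimal_upto M' (hp + m + m + m) (next_pair T).
Proof.
move=> [has [Ehas out opt]] hp32 Tm F /(_ has Ehas)[[[K0 K1 K2 K3] tryT]|[nskip [O BI BG H [f ff hf]]]].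
  exists has; rewrite K0 K1 K2 K3; split=> //.
    move=> /out[lo hi [f ff hf]]; split=> //; first by lia.
    by exists f => // g; rewrite F ?hf //; have := ltn_ord g; lia.
  move=> i g f gm; rewrite tried_before_next // => /orP[old|/andP[/eqP-> /eqP->]] ff.
    exact: opt old ff.
  by case: tryT => // /(_ f); case; case: (T) ff.
exists true; rewrite O BI BG H; split=> //.
  move=> _; split; [by lia|by lia|by exists f].
move=> i g f' gm; rewrite tried_before_next // => /orP[old|/andP[/eqP-> /eqP->]] ff' /=.
  have /andP[has1 le1] := opt _ _ _ gm old ff'.
  move: nskip; rewrite has1 /= => nle.
  by apply: cmpD_trans le1; have := cmpD_total T.1 T.2 (M rBI) (M rBG); rewrite (negbTE nle) orbF.
by have := cmpD_total T.1 T.2 T.1 T.2; rewrite orbb.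
Qed.

Lemma search_step M hp T : search M hp T -> T.1 < n ->
  exists t M', [/\ t <= (m * m).+1 * (11 * m + 29) + 18, reach t lTry M lTry M' &
    search M' (hp + m + m + m) (next_pair T)].
Proof.
move=> [R hp32 z Tm opt] Tn; case: (opt) => has [Ehas _ _].
have [t1 [M1 [ht1 r1 [F1 FF] Fh out]]] := try_block hp32 R Tn Ehas z.
case: (R) => E1 E4 E5 E6 [E9 E10 EK EN].
have [t2 [M2 [ht2 r2 H2 T2 F2]]] : exists t M', [/\ t <= 6, reach t lNext M1 lTry M',
    M' rH = hp + m + m + m, (M' rTI, M' rTG) = next_pair T &
    forall a, a != rH -> a != rTI -> a != rTG -> M' a = M1 a].
  by apply: next_block; rewrite ?FF // F1 //; lia.
exists (t1 + t2), M2; split; first by lia.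
  exact: reach_trans r1 r2.
have F a : a \in [:: rM; rK; rN; rZero; rOne] -> M2 a = M a.
  by move=> ha; rewrite F2 ?F1 //; move: ha; rewrite !inE; lia.
have Fhigh a : 25 <= a -> ~~ (hp <= a < hp + m + m + m) -> M2 a = M a.
  by move=> ha ha'; rewrite F2 ?Fh //; lia.
split.
- by split; [rewrite F|rewrite F|rewrite F|rewrite H2|split; [rewrite -T2|rewrite -T2|rewrite F|rewrite F]].
- by lia.
- by move=> a ha; rewrite Fhigh ?z //; lia.
- by rewrite /next_pair; case: ifP.
- apply: (@optimal_next M) => // has' Ehas'.
  have -> : has' = has by move: Ehas'; rewrite Ehas; case: has' (has) => [] [].
  case: out => [[[K0 K1 K2 K3] tryT]|[ns [O BI BG H [f ff hf]]]]; [left|right]; split=> //.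
    by rewrite /kept !F2.
  split; rewrite ?F2 //; exists f => // g.
  by rewrite F2 ?hf //; lia.
Qed.

(** [T.1 * m + T.2] is the rank of [T] in row-major order, and each trial raises it by one. *)
Lemma search_loop M hp T : search M hp T ->
  exists t M' hp' T', [/\ t <= (n * m - (T.1 * m + T.2)) *
      ((m * m).+1 * (11 * m + 29) + 18) + 1,
    reach t lTry M lHalt M', search M' hp' T' & n <= T'.1].
Proof.
have [r] := ubnP (n * m - (T.1 * m + T.2)); elim: r => // r IH in M hp T * => lt_r S.
have [nT|Tn] := leqP n T.1.
  exists 1, M, hp, T; split=> //; first by rewrite leq_addl.
  case: (S) => -[_ _ _ _ [E9 _ _ EN]] _ _ _ _.
  by step; rewrite nT; apply: reach0.
have [t1 [M1 [ht1 r1 S1]]] := search_step S Tn.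
have Tm := se_T S.
have le_row : T.1.+1 * m <= n * m by rewrite leq_mul2r Tn orbT.
have lt_next : (next_pair T).1 * m + (next_pair T).2 = (T.1 * m + T.2).+1.
  by rewrite /next_pair; case: (ltnP T.2.+1 m) => /= lt; rewrite ?mulSn; lia.
move: le_row; rewrite mulSn => le_row.
have [|t2 [M2 [hp2 [T2 [ht2 r2 S2 nT2]]]]] := IH _ _ _ _ S1; first by rewrite lt_next; lia.
exists (t1 + t2), M2, hp2, T2; split=> //; last exact: reach_trans r1 r2.
set C := (_ + 18) in ht1 ht2 *.
have -> : n * m - (T.1 * m + T.2) = (n * m - (T.1 * m + T.2).+1).+1 by lia.
by rewrite mulSn -lt_next -addnA leq_add.
Qed.

(** The feasible [T0] guarantees that some assignment has been recorded when the search ends. *)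
Lemma prog_optimal T0 f0 : T0.1 < n -> T0.2 < m -> feasible T0 f0 ->
  exists t M, [/\ t <= n * m * ((m * m).+1 * (11 * m + 29) + 18) + 5,
    reach t 0 (init_mem n m k) lHalt M &
    exists T f, [/\ feasible T f, forall g : 'I_m, M (M rOut + g) = (f g).1 &
      forall i g f', i < n -> g < m -> feasible (i, g) f' -> cmpD T.1 T.2 i g]].
Proof.
move=> T0n T0m ff0; set I := init_mem n m k.
have [I0 I1 I2 I4] : [/\ I 0 = n, I 1 = m, I 2 = k & I 4 = 0] by [].
pose M1 := upd (upd (upd I rN n) rOne 1) rH 32.
have r1 : reach 4 0 I lTry M1.
  by do 3 step; step; rewrite leqNgt m_gt0 /=; apply: reach0.
have S1 : search M1 32 (0, 0).
  split=> //.
  - move=> a ha; rewrite /M1; look_all; rewrite /I /init_mem.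
    by case: a ha => [|[|[|]]].
  - exists false; split=> // i g f _.
    by rewrite /tried_before /= ltn0 andbF.
have [t2 [M2 [hp [T [ht2 r2 S2 nT]]]]] := search_loop S1.
exists (4 + t2), M2; split.
- by move: ht2; rewrite /= mul0n subn0; lia.
- exact: reach_trans r1 r2.
have [has [_ out opt]] := se_opt S2.
have tried i g : i < n -> tried_before T i g by move=> lt_i; rewrite /tried_before; lia.
have /andP[/out[_ _ [f ff hf]] _] : has && cmpD (M2 rBI) (M2 rBG) T0.1 T0.2.
  exact: opt T0m (tried _ _ T0n) ff0.
exists (M2 rBI, M2 rBG), f; split=> // i g f' lt_i lt_g ff'.
by have /andP[] := opt _ _ _ lt_g (tried _ _ lt_i) ff'.
Qed.


Lemma prog_no_items : exists M, reach 4 0 (init_mem n 0 k) lHalt M.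
Proof. by eexists; do 3 step; step; rewrite /=; apply: reach0. Qed.

Lemma run_reach t M M' fuel :
  reach t 0 M lHalt M' -> t < fuel -> run cmpD cmpQ prog fuel 0 M = Some M'.
Proof. by move=> r lt; rewrite -(subnKC lt) addSnnS r. Qed.

End Machine.

(** * Quantile costs *)

Local Open Scope ring_scope.
Section Quantiles.
Variable R : realFieldType.
Implicit Types (t theta x : R) (s : seq R).

(** The condition defining the ceiling is monotone in [c] and holds at [k] as [t <= 1], so the
    search for the least [c] succeeds. *)
Lemma qceil_leq t (k c : nat) : 0 <= t <= 1 -> (c <= k)%N ->
  (qceil t k <= c)%N = (t * k%:R <= c%:R).
Proof.
move=> /andP[t0 t1] ck; pose p (c : nat) := t * k%:R <= c%:R.
have has_p : has p (iota 0 k.+1).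
  by apply/hasP; exists k; [rewrite mem_iota add0n ltnS leqnn | rewrite /p ler_piMl ?ler0n].
have lt_q : (qceil t k < k.+1)%N by rewrite -[X in (_ < X)%N](size_iota 0) -has_find.
rewrite leqNgt; have [lt_c|le_q] := ltnP.
  by have := before_find 0%N lt_c; rewrite nth_iota //= add0n => ->.
have := nth_find 0%N has_p; rewrite nth_iota // add0n /p => /le_trans -> //.
by rewrite ler_nat.
Qed.

Lemma qceil_pred_ltn t (k : nat) : 0 <= t <= 1 -> (0 < k)%N -> ((qceil t k).-1 < k)%N.
Proof.
move=> t01 k0; rewrite -ltnS; have := qceil_leq t01 (leqnn k).
rewrite ler_piMl //; last by case/andP: t01.
by case: (qceil t k) => //= q; lia.
Qed.

(** In decreasing order the entries above [theta] form a prefix, and entry [q] lies outside it iff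
    its length is at most [q]. *)
Lemma nth_le_count s theta (q : nat) : sorted >=%R s -> (q < size s)%N ->
  (nth 0 s q <= theta) = (count (> theta) s <= q)%N.
Proof.
move=> srt qs.
have le_nth i j : (i <= j < size s)%N -> nth 0 s j <= nth 0 s i.
  move=> /andP[ij js]; apply: (sorted_leq_nth ge_trans ge_refl 0 srt) => //.
  exact: leq_ltn_trans js.
apply/idP/idP => [le_theta|].
  rewrite -(cat_take_drop q s) count_cat.
  have -> : count (> theta) (drop q s) = 0%N.
    apply/eqP; rewrite -leqn0 leqNgt -has_count; apply/hasPn => x /(nthP 0)[i].
    rewrite size_drop nth_drop => lt_i <-; rewrite -leNgt.
    by apply: le_trans le_theta; apply: le_nth; rewrite leq_addr -ltn_subRL.
  by rewrite addn0; apply: leq_trans (count_size _ _) _; rewrite size_take; case: ifP => //; lia.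
apply: contraTT; rewrite -ltNge -ltnNge => lt_theta.
rewrite -(cat_take_drop q.+1 s) count_cat.
have -> : count (> theta) (take q.+1 s) = q.+1 by
  rewrite -[RHS](size_takel qs); apply/eqP; rewrite -all_count; apply/(all_nthP 0) => i;
  rewrite size_takel // => lt_i; rewrite nth_take //; apply: lt_le_trans lt_theta _;
  apply: le_nth; lia.
exact: leq_addr.
Qed.

Variable m : nat.
Implicit Types (di : 'I_m -> R) (S : {set 'I_m}).

Definition by_disutility di S : seq 'I_m :=
  sort (fun g h : 'I_m => di h <= di g) (enum S).

(** For [t = 0] the ceiling is 0 and its truncated predecessor is again 0, so the two cases of
    [qdis] coincide. *)
Lemma qdis_nth di t S : 0 <= t <= 1 ->
  qdis di t S = nth 0 (map di (by_disutility di S)) (qceil t #|S|).-1.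
Proof.
move=> t01; rewrite /qdis; case: ifP => // tn.
have t0 : t = 0 by apply: le_anti; rewrite leNgt tn; case/andP: t01.
have := qceil_leq t01 (leq0n #|S|); rewrite {2}t0 mul0r lexx leqn0 => /eqP.
by case: qceil.
Qed.

Lemma sorted_by_disutility di S : sorted >=%R (map di (by_disutility di S)).
Proof. by rewrite sorted_map; apply: sort_sorted => g h; apply: le_total. Qed.

Lemma qdis_le di t S theta : 0 <= t <= 1 -> (0 < #|S|)%N ->
  (qdis di t S <= theta) = (#|[set g in S | (theta < di g)%R]| <= (qceil t #|S|).-1)%N.
Proof.
move=> t01 S0; rewrite qdis_nth // nth_le_count ?sorted_by_disutility //; last first.
  by rewrite size_map size_sort -cardE qceil_pred_ltn.
rewrite count_map (permP (permEl (perm_sort _ _))) -size_filter; congr (_ <= _)%N.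
rewrite cardE; apply/perm_size/uniq_perm => [||g].
- by apply: filter_uniq; apply: enum_uniq.
- exact: enum_uniq.
by rewrite mem_filter !mem_enum !inE andbC.
Qed.

(** This is why only the disutilities of single items have to be tried as thresholds. *)
Lemma qdis_attained di t S : 0 <= t <= 1 -> (0 < #|S|)%N -> exists g, qdis di t S = di g.
Proof.
move=> t01 S0; rewrite qdis_nth //.
have lt_q : ((qceil t #|S|).-1 < size (by_disutility di S))%N.
  by rewrite size_sort -cardE qceil_pred_ltn.
have [g0 _] : exists g0, g0 \in S by apply/set0Pn; rewrite -card_gt0.
by rewrite (nth_map g0) //; eexists.
Qed.

End Quantiles.

(** * Balanced allocations as slot assignments *)

Section Reduction.
Variables (R : realFieldType) (n m k : nat) (d : 'I_n -> 'I_m -> R) (tau : 'I_n -> R).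
Hypothesis m_kn : m = (k * n)%N.
Hypothesis d_ge0 : forall i g, 0 <= d i g.
Hypothesis tau01 : forall i, 0 <= tau i <= 1.

Local Notation feas := (@feasible (oracleD d) (oracleQ tau) n m k).
Local Notation cap := (@cap_upto (oracleQ tau) n k k).
Local Notation free_slots i := (qceil (tau i) k).-1.

Lemma dnatE (i : 'I_n) (g : 'I_m) : dnat d i g = d i g.
Proof. by rewrite /dnat !valK. Qed.

Lemma taunatE (i : 'I_n) : taunat tau i = tau i.
Proof. by rewrite /taunat valK. Qed.

Lemma count_ltn q l : (q <= l)%N -> count (fun j => j < q)%N (iota 0 l) = q.
Proof.
move=> /subnKC <-; rewrite iotaD count_cat add0n.
rewrite (@eq_in_count _ _ predT) => [|j]; last by rewrite mem_iota.
rewrite count_predT size_iota (@eq_in_count _ _ pred0) ?count_pred0 ?addn0 // => j.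
by rewrite mem_iota => /andP[le _]; rewrite ltnNge le.
Qed.

(** Slot [j] is free iff [j + 1] is below the ceiling; as [j] starts from 0, their number is the
    ceiling's predecessor. *)
Lemma cap_free (i : 'I_n) : (0 < k)%N -> cap (i, false) = free_slots i.
Proof.
move=> k0; rewrite -[RHS](@count_ltn _ k); last by rewrite ltnW // qceil_pred_ltn.
apply: eq_in_count => j; rewrite mem_iota add0n => /andP[_ jk].
rewrite /oracleQ taunatE -qceil_leq //= eqbF_neg -ltnNge.
by case: (qceil _ _).
Qed.

Lemma cap_strict (i : 'I_n) : (cap (i, false) + cap (i, true))%N = k.
Proof.
rewrite /cap_upto /= -[RHS](size_iota 0) addnC.
rewrite -(count_predC (fun j => oracleQ tau i k j.+1)).
by congr addn; apply: eq_count => j /=; rewrite ?eqb_id ?eqbF_neg.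
Qed.

Lemma bundle_feasible T f (i : 'I_n) : feas T f ->
  #|bundle (fun g => (f g).1) i| = k.
Proof.
move=> [hf _]; rewrite -(cap_strict i) -!hf -cardUI.
rewrite [X in (_ + X)%N]eq_card0 ?addn0 => [|g]; last first.
  by rewrite !inE; case: (f g) => a b; rewrite !xpair_eqE; case: b; rewrite /= ?andbF.
by apply: eq_card => g; rewrite !inE; case: (f g) => a [];
  rewrite !xpair_eqE /= ?andbT ?andbF ?orbF.
Qed.

(** Items above the threshold can sit only in free slots, whose number is the bound in [qdis_le]. *)
Lemma feasible_qdis (T : nat * nat) f (i : 'I_n) : (0 < k)%N -> feas T f ->
  qdis (d i) (tau i) (bundle (fun g => (f g).1) i) <= dnat d T.1 T.2.
Proof.
move=> k0 ff; have Ek := bundle_feasible i ff; case: (ff) => hf hacc.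
rewrite qdis_le ?Ek // -cap_free // -hf.
apply/subset_leq_card/subsetP => g; rewrite !inE => /andP[/eqP <- lt].
have := hacc g; rewrite /acc /oracleD /= dnatE; case: (f g) lt => a [] //= lt.
by rewrite leNgt lt.
Qed.

(** Each bundle is sorted by decreasing disutility and its first [free_slots] items take the free
    slots. The others come at or after the quantile position, so their disutility is at most the
    cost of the bundle. *)
Lemma balanced_feasible (b : 'I_m -> 'I_n) (T : nat * nat) : (0 < k)%N -> balanced k b ->
  (forall i, qdis (d i) (tau i) (bundle b i) <= dnat d T.1 T.2) ->
  exists f, feas T f.
Proof.
move=> k0 bal le_T; pose L i := by_disutility (d i) (bundle b i).
have szL i : size (L i) = k by rewrite size_sort -cardE bal.
have memL i g : (g \in L i) = (b g == i) by rewrite mem_sort mem_enum inE.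
have uniqL i : uniq (L i) by rewrite sort_uniq enum_uniq.
have q_lt i : (free_slots i < k)%N by apply: qceil_pred_ltn.
exists (fun g => (b g, free_slots (b g) <= index g (L (b g)))%N).
have cfree i : #|[pred g | (b g == i) && (index g (L i) < free_slots i)%N]| = free_slots i.
  have /card_uniqP E : uniq (take (free_slots i) (L i)) by rewrite take_uniq.
  have szT : size (take (free_slots i) (L i)) = free_slots i.
    by apply: size_takel; rewrite szL ltnW.
  rewrite -[in RHS]szT -E; apply: eq_card => g.
  rewrite !inE -memL; case: (boolP (g \in L i)) => [gL|gL] /=.
    by rewrite in_take.
  by apply/esym/negbTE; apply: contra gL; apply: mem_take.
split=> [[i s]|g].
  have cE : #|[pred g | b g == i & (index g (L i) < free_slots i)%N]| = cap (i, false).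
    by rewrite cfree cap_free.
  case: s; last first.
    apply: etrans cE; apply: eq_card => g; rewrite !inE xpair_eqE eqbF_neg -ltnNge.
    by case: eqP => [->|].
  (* The strict fiber is the complement of the free one in a bundle of size [k]. *)
  apply: (@addnI (cap (i, false))); rewrite cap_strict -cE -[RHS](bal i).
  rewrite -(cardID [pred g | index g (L i) < free_slots i]%N (bundle b i)).
  congr (_ + _)%N; apply: eq_card => g; rewrite !inE ?xpair_eqE.
    by [].
  by rewrite eqb_id -leqNgt andbC; case: eqP => [->|]; rewrite ?andbT ?andbF.
rewrite /acc /oracleD /= dnatE; apply/implyP => le_q.
apply: le_trans (le_T (b g)); rewrite qdis_nth // bal.
have gL : g \in L (b g) by rewrite memL.
have gi : (index g (L (b g)) < k)%N by rewrite -[X in (_ < X)%N](szL (b g)) index_mem.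
rewrite -[X in _ X <= _](nth_index g gL) -(nth_map g 0) ?szL //.
apply: (sorted_leq_nth ge_trans ge_refl 0 (sorted_by_disutility _ _)) => //;
  by rewrite inE size_map szL.
Qed.

Hypotheses (n_gt0 : (0 < n)%N) (k_gt0 : (0 < k)%N).

(** The threshold is the cost of a costliest agent, which is a disutility of that agent and bounds
    the cost of every agent. *)
Lemma balanced_threshold (b : 'I_m -> 'I_n) : balanced k b ->
  exists (i : 'I_n) (g : 'I_m) f, feas (val i, val g) f /\ d i g <= ESC d tau b.
Proof.
move=> bal; pose i0 := Ordinal n_gt0; pose q i := qdis (d i) (tau i) (bundle b i).
case: (@arg_maxP _ _ _ i0 predT q isT) => i _ max_i.
have [g Eg] : exists g, q i = d i g by apply: qdis_attained => //; rewrite bal.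
have le_q i' : q i' <= dnat d i g by rewrite dnatE -Eg; apply: max_i.
have [f ff] := @balanced_feasible b (val i, val g) k_gt0 bal le_q.
exists i, g, f; split=> //.
by rewrite -Eg /ESC; apply: le_bigmax.
Qed.

(** Through [balanced_threshold] this supplies the feasible pair that [prog_optimal] asks for. *)
Lemma balanced_exists : exists b : 'I_m -> 'I_n, balanced k b.
Proof.
have E : m = #|{: 'I_n * 'I_k}| by rewrite card_prod !card_ord mulnC.
pose h (g : 'I_m) := enum_val (cast_ord E g).
have inj : injective h by move=> g g' /enum_val_inj /cast_ord_inj.
have bij : bijective h by apply: inj_card_bij => //; rewrite -E card_ord.
exists (fun g => (h g).1) => i.
have -> : bundle (fun g => (h g).1) i = h @^-1: setX [set i] setT.
  by apply/setP => g; rewrite !inE andbT.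
rewrite on_card_preimset; last by apply: onW_bij.
by rewrite cardsX cards1 cardsT card_ord mul1n.
Qed.

Lemma ESC_le (a : 'I_m -> 'I_n) theta : 0 <= theta ->
  (forall i, qdis (d i) (tau i) (bundle a i) <= theta) -> ESC d tau a <= theta.
Proof. by move=> th0 le_th; apply: bigmax_le => // i _; apply: le_th. Qed.

(** For every balanced [b] the cost of the output is at most the threshold found, which is at most
    the feasible threshold that [b] provides, which is at most the cost of [b]. *)
Lemma prog_correct : exists t M,
  [/\ (t <= n * m * ((m * m).+1 * (11 * m + 29) + 18) + 5)%N,
      reach (oracleD d) (oracleQ tau) t 0 (init_mem n m k) lHalt M &
      exists a : 'I_m -> 'I_n,
        (forall g : 'I_m, M (M 0%N + g)%N = nat_of_ord (a g)) /\
        balanced k a /\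
        (forall b : 'I_m -> 'I_n, balanced k b -> ESC d tau a <= ESC d tau b)].
Proof.
have m_gt0 : (0 < m)%N by rewrite m_kn muln_gt0 k_gt0.
have [b0 bal0] := balanced_exists; have [i0 [g0 [f0 [ff0 _]]]] := balanced_threshold bal0.
have total i g j h : oracleD d i g j h || oracleD d j h i g by apply: le_total.
have trans i g j h i' g' : oracleD d i g j h -> oracleD d j h i' g' -> oracleD d i g i' g'.
  exact: le_trans.
have [t [M [ht r [T [f [ff hf opt]]]]]] :=
  @prog_optimal _ _ n m k m_kn n_gt0 m_gt0 total trans (val i0, val g0) f0
    (ltn_ord i0) (ltn_ord g0) ff0.
exists t, M; split=> //; exists (fun g => (f g).1); split=> //; split.
  by move=> i; apply: bundle_feasible ff.
move=> b bal; have [i [g [f' [ff' le_b]]]] := balanced_threshold bal.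
apply: le_trans le_b; apply: ESC_le => // i'.
apply: le_trans (feasible_qdis i' k_gt0 ff) _; rewrite -dnatE.
exact: opt (ltn_ord i) (ltn_ord g) ff'.
Qed.

End Reduction.

(* There is a single RAM program P and a polynomial bound c*(n+m+1)^e
   such that on every instance (n agents, m = k n chores, disutilities
   d >= 0, quantiles tau in [0,1]) P halts within that many steps, and the
   output (item g assigned to agent M[M[0] + g]) is a balanced allocation
   minimizing ESC among all balanced allocations. *)
Theorem theorem9 :
  exists (P : program) (c e : nat),
  forall (R : realFieldType) (n m k : nat)
         (d : 'I_n -> 'I_m -> R) (tau : 'I_n -> R),
    m = (k * n)%N ->
    (forall i g, 0 <= d i g) ->
    (forall i, 0 <= tau i <= 1) ->
    exists M : memory,
      run (oracleD d) (oracleQ tau) P (c * (n + m).+1 ^ e)%N 0 (init_mem n m k)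
        = Some M /\
      exists a : 'I_m -> 'I_n,
        (forall g : 'I_m, M (M 0%N + g)%N = nat_of_ord (a g)) /\
        balanced k a /\
        (forall b : 'I_m -> 'I_n, balanced k b -> ESC d tau a <= ESC d tau b).
Proof.
(* With [N = n + m + 1] there are at most [N^2] trials of at most [47 * N^3] steps each; the
   remaining [13 * N^5] absorbs the additive 5 and makes the inequality strict. *)
exists prog, 60, 5 => R n m k d tau m_kn d_ge0 tau01.
(* Without items the program exits before any trial and all bundles are empty; either [k = 0] or
   there is no agent. *)
have [m0|m_gt0] := posnP m.
  move: d d_ge0 m_kn; rewrite m0 => d d_ge0 kn0.
  have noitem (P : 'I_0 -> Prop) g : P g by case: g.
  have [M r] := prog_no_items (oracleD d) (oracleQ tau) n k.
  exists M; split.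
    apply: run_reach r _; apply: (@leq_ltn_trans (4 * 1)%N) => //.
    by apply: (@leq_trans (60 * 1)%N) => //; rewrite leq_mul2l expn_gt0.
  exists (fun g => match noitem (fun=> False) g with end); split; first by case.
  have E (a b : 'I_0 -> 'I_n) i : bundle a i = bundle b i by apply/setP; case.
  split=> [i|b _].
    have k0 : k = 0%N.
      by move/esym/eqP: kn0; rewrite muln_eq0 => /orP[/eqP//|/eqP n0]; case: i => i; rewrite n0.
    by rewrite k0; apply: eq_card0; case.
  by rewrite /ESC; under eq_bigr => i _ do rewrite (E _ b).
have [k_gt0 n_gt0] : (0 < k)%N /\ (0 < n)%N.
  by apply/andP; rewrite -muln_gt0 -m_kn.
have [t [M [ht r out]]] := prog_correct m_kn d_ge0 tau01 n_gt0 k_gt0.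
exists M; split=> //; apply: run_reach r _; apply: leq_ltn_trans ht _.
set N := (n + m).+1.
have le1 : (n * m <= N * N)%N by apply: leq_mul; lia.
have le2 : ((m * m).+1 <= N * N)%N.
  by apply: (@leq_trans (m.+1 * m.+1)%N); [lia|apply: leq_mul; lia].
have le3 : ((m * m).+1 * (11 * m + 29) <= N * N * (29 * N))%N by apply: leq_mul => //; lia.
have N3 : (0 < N * N * N)%N by [].
have le4 : ((m * m).+1 * (11 * m + 29) + 18 <= 47 * (N * N * N))%N by lia.
have le5 : (n * m * ((m * m).+1 * (11 * m + 29) + 18) <= N * N * (47 * (N * N * N)))%N.
  exact: leq_mul.
have -> : (60 * N ^ 5 = 47 * (N * N * (N * N * N)) + 13 * (N * N * (N * N * N)))%N.
  by rewrite -mulnDl /= !expnS expn0 muln1 !mulnA.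
have N5 : (0 < N * N * (N * N * N))%N by [].
lia.
Qed.
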